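(* Assume $\lambda<\mu_1$, $\lambda<\mu_2$ (and $\mu_1\neq\mu_2$). Let $$h_{\rho_2}(y)=C(\rho_2,\rho_1)\,\rho_2^{y(1)-y(2)}-C(\rho_2,1)\,\rho_2^{y(1)-y(2)}\rho_1^{y(2)}.$$ Then $h_{\rho_2}$ is $\partial B$-determined, and for all $y\in B$, $$P_y(\tau<\infty)=\frac{1}{C(\rho_2,\rho_1)}h_{\rho_2}(y)+\frac{C(\rho_2,1)}{C(\rho_2,\rho_1)}\rho_1^{y(1)-y(2)}\rho_1^{y(2)},$$ i.e. $$P_y(\tau<\infty)=\rho_2^{y(1)-y(2)}+\frac{\mu_2-\lambda}{\mu_1-\mu_2}\rho_2^{y(1)-y(2)}\rho_1^{y(2)}+\frac{\mu_2-\lambda}{\mu_2-\mu_1}\rho_1^{y(1)-y(2)}\rho_1^{y(2)}.$$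
   Context: Let $\lambda,\mu_1,\mu_2>0$ with $\lambda+\mu_1+\mu_2=1$, and $\rho_i=\lambda/\mu_i$, $i=1,2$. $Y$ is the constrained random walk on $\mathbb{Z}\times\mathbb{Z}_+$: $Y_{k+1}=Y_k+\pi_1(Y_k,J_k)$, where the $J_k$ are i.i.d. with $P(J_k=(-1,0))=\lambda$, $P(J_k=(1,1))=\mu_1$, $P(J_k=(0,-1))=\mu_2$, and $\pi_1(y,v)=v$ if $y+v\in\mathbb{Z}\times\mathbb{Z}_+$, $\pi_1(y,v)=0$ otherwise. $P_y$, $\mathbb{E}_y$ refer to $Y_0=y$. $B=\{y\in\mathbb{Z}\times\mathbb{Z}_+: y(1)\ge y(2)\}$, $\partial B=\{y\in\mathbb{Z}\times\mathbb{Z}_+:y(1)=y(2)\}$, $\tau=\inf\{k:Y_k\in\partial B\}$. $C(\beta,\alpha)=\mu_2(1-\beta/\alpha)$; thus $C(\rho_2,\rho_1)=\mu_2-\mu_1$ and $C(\rho_2,1)=\mu_2-\lambda$. A function $V$ is $Y$-harmonic if $V(y)=\mathbb{E}_y[V(Y_1)]$ for $y\in B$. A $Y$-harmonic function $h$ is called $\partial B$-determined if there is a function $f$ on $\partial B$ such that $h(y)=\mathbb{E}_y[f(Y_\tau)1_{\{\tau<\infty\}}]$ for all $y\in B$. *)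

(* Defs.v *)
From HB Require Import structures.
From mathcomp Require Import all_boot all_order all_algebra.
From mathcomp Require Import all_classical all_reals all_analysis.

Set Implicit Arguments.
Unset Strict Implicit.
Unset Printing Implicit Defensive.
Import Order.TTheory GRing.Theory Num.Theory.
Import numFieldNormedType.Exports.
Local Open Scope classical_set_scope.
Local Open Scope ring_scope.

HB.instance Definition _ := isPointed.Build int 0.

(* The discrete sigma-algebra on Z; the product sigma-algebra it induces on
   [int * int] is then also the discrete one. *)
HB.instance Definition _ := @isMeasurable.Build default_measure_display int
  discrete_measurable discrete_measurable0
  discrete_measurableC discrete_measurableU.

Notation site := (int * int)%type.

(* Mutual independence of a sequence of random variables: the product rule
   holds on every finite subfamily. *)
Definition mutually_independent d d' (T : measurableType d)
    (S : measurableType d') (R : realType) (P : probability T R)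
    (X : nat -> {RV P >-> S}) : Prop :=
  forall (I : seq nat) (A : nat -> set S), uniq I ->
    (forall i, measurable (A i)) ->
    P (\bigcap_(i in [set` I]) (X i @^-1` A i)) =
    (\prod_(i <- I) P (X i @^-1` A i))%E.

Record iid_steps d (T : measurableType d) (R : realType) (P : probability T R)
    (lam mu1 mu2 : R) (J : nat -> {RV P >-> site}) : Prop := IidSteps {
  steps_left : forall k, P (J k @^-1` [set (- 1, 0)]) = lam%:E ;
  steps_diag : forall k, P (J k @^-1` [set (1, 1)]) = mu1%:E ;
  steps_down : forall k, P (J k @^-1` [set (0, - 1)]) = mu2%:E ;
  steps_indep : mutually_independent J }.

Definition in_halfplane (y : site) : bool := 0 <= y.2.

Definition pi1 (y v : site) : site := if in_halfplane (y + v) then v else 0.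

Definition in_B (y : site) : bool := in_halfplane y && (y.2 <= y.1).

Definition in_dB (y : site) : bool := in_halfplane y && (y.1 == y.2).

Section Walk.
Context d (T : measurableType d) (R : realType) (P : probability T R).
Variable J : nat -> {RV P >-> site}.

Fixpoint walk (y : site) (k : nat) (w : T) : site :=
  if k is k'.+1 then walk y k' w + pi1 (walk y k' w) (J k' w) else y.

(* [None] stands for tau = +oo, i.e. the infimum of the empty set. *)
Definition tau (y : site) (w : T) : option nat :=
  match pselect (exists k, in_dB (walk y k w)) with
  | left hit => Some (ex_minn hit)
  | right _ => None
  end.

Definition hits (y : site) : set T := [set w | tau y w != None].

(* f(Y_tau) 1_{tau < oo}. *)
Definition stopped_payoff (f : site -> R) (y : site) (w : T) : R :=
  if tau y w is Some k then f (walk y k w) else 0.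

Definition Y_harmonic (V : site -> R) : Prop :=
  forall y, in_B y -> 'E_P[V \o walk y 1]%E = (V y)%:E.

(* The payoff f is only ever evaluated on dB. Integrability makes the
   expectation meaningful, since the library's integral is total. *)
Definition dB_determined (h : site -> R) : Prop :=
  Y_harmonic h /\
  exists f : site -> R, forall y, in_B y ->
    P.-integrable setT (EFin \o stopped_payoff f y) /\
    (h y)%:E = 'E_P[stopped_payoff f y]%E.

End Walk.

Definition C (R : realType) (mu2 beta alpha : R) : R :=
  mu2 * (1 - beta / alpha).

Definition h_rho2 (R : realType) (mu2 rho1 rho2 : R) (y : site) : R :=
  C mu2 rho2 rho1 * rho2 ^ (y.1 - y.2)
  - C mu2 rho2 1 * (rho2 ^ (y.1 - y.2) * rho1 ^ y.2).

(* Main.v *)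
Require Import Defs.
From mathcomp Require Import all_boot all_order all_algebra.
From mathcomp Require Import all_classical all_reals all_analysis.
From mathcomp Require Import measurable_realfun.
From mathcomp Require Import zify ring lra.
Set Implicit Arguments.
Unset Strict Implicit.
Unset Printing Implicit Defensive.
Import Order.TTheory GRing.Theory Num.Theory.
Import numFieldNormedType.Exports.
Local Open Scope classical_set_scope.
Local Open Scope ring_scope.

(** Write x = y(1) - y(2) for the gap between the walk and the boundary dB.
    The functions beta^x alpha^y(2) are eigenfunctions of the one-step
    averaging operator away from the axis y(2) = 0, with eigenvalue
    lam/beta + mu1 alpha + mu2 beta/alpha; on the axis the suppressed
    downward step adds the defect C(beta, alpha) ([one_step_geom]).  The three
    pairs (rho2, 1), (rho2, rho1) and (rho1, rho1) all have eigenvalue 1, the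
    last one has no defect, and the coefficients of h_rho2 are chosen so that
    the defects of the first two cancel.  Hence h_rho2 is harmonic, and so is
    the proposed formula W for the hitting probability, which moreover equals
    1 on dB.

    It remains to see that a harmonic V with |V| <= K r^x, r < 1, is the
    expectation of its own value at tau ([harmonic_determined]).  The error
    V(y) - E_y[V(Y_tau); tau <= n] is E_y[V(Y_n); tau > n], and only the event
    that the gap of Y_n is small matters, since V is below K r^M when the gap
    exceeds M.  From a gap of at most M the walk reaches dB within M further
    steps with probability at least lam^M, by stepping left; so that event has
    probability at most lam^-M P_y(n < tau <= n + M), which tends to 0 because
    P_y(tau <= n) converges.  The estimate is [harmonic_defect].

    The estimate is proved for finite sums over words of steps
    ([word_mean], [reach]).  Independence identifies those sums with
    expectations of functionals of the first n steps
    ([expectation_first_steps]), and dominated convergence lets n tend to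
    infinity ([expectation_stopped]). *)

(** * One step of the walk *)

Local Notation steps := ([:: (-1, 0); (1, 1); (0, -1)] : seq site).

Definition move (y v : site) : site := y + pi1 y v.

Definition one_step {R : realType} (lam mu1 mu2 : R) (g : site -> R)
    (y : site) : R :=
  lam * g (move y (-1, 0)) + mu1 * g (move y (1, 1)) +
  mu2 * g (move y (0, -1)).

Definition harmonic_off_dB {R : realType} (lam mu1 mu2 : R) (V : site -> R) :=
  forall y, in_B y -> ~~ in_dB y -> one_step lam mu1 mu2 V y = V y.

Lemma move_left (y : site) : in_B y -> move y (-1, 0) = (y.1 - 1, y.2).
Proof.
case: y => a b; rewrite /move /pi1 /in_B /in_halfplane /= => /andP[hb _].
by rewrite addr0 hb; congr pair => /=; rewrite addr0.
Qed.

Lemma move_diag (y : site) : in_B y -> move y (1, 1) = (y.1 + 1, y.2 + 1).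
Proof.
case: y => a b; rewrite /move /pi1 /in_B /in_halfplane /= => /andP[hb _].
by rewrite addr_ge0.
Qed.

Lemma move_down (y : site) : in_B y ->
  move y (0, -1) = (y.1, if y.2 == 0 then 0 else y.2 - 1).
Proof.
case: y => a b; rewrite /move /pi1 /in_B /in_halfplane /= => /andP[hb _].
case: eqVneq => [->|b0] /=.
  by congr pair => /=; rewrite addr0.
by rewrite ifT; [congr pair => /=; rewrite addr0 | lia].
Qed.

Lemma B_move (y v : site) : in_B y -> ~~ in_dB y ->
  v \in steps -> in_B (move y v).
Proof.
move=> By dy; have := By; have := dy; rewrite /in_dB /in_B /in_halfplane.
rewrite !inE => + + /or3P[]/eqP ->;
  rewrite ?move_left ?move_diag ?move_down //=; case: y {By dy} => a b /=;
  try case: ifP; lia.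
Qed.

Lemma gap_ge0 (y : site) : in_B y -> 0 <= y.1 - y.2.
Proof. by rewrite subr_ge0 => /andP[]. Qed.

(** * Sums over step words and the defect estimate *)

Section OneStep.
Context {R : realType}.
Variables lam mu1 mu2 : R.
Hypotheses (lam_gt0 : 0 < lam) (mu1_gt0 : 0 < mu1) (mu2_gt0 : 0 < mu2).
Hypothesis sum_eq1 : lam + mu1 + mu2 = 1.
Implicit Types (f g : site -> R) (y v : site) (s : seq site).
Notation Q := (one_step lam mu1 mu2).

Lemma lam_le1 : lam <= 1.
Proof. by move: mu1_gt0 mu2_gt0 sum_eq1; lra. Qed.

Lemma one_stepB f g y : Q (fun z => f z - g z) y = Q f y - Q g y.
Proof. rewrite /one_step; ring. Qed.

Lemma le_norm_one_step f g y :
  (forall v, v \in steps -> `|f (move y v)| <= g (move y v)) ->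
  `|Q f y| <= Q g y.
Proof.
move=> H; rewrite /one_step; apply: (le_trans (ler_normD _ _)); apply: lerD.
  apply: (le_trans (ler_normD _ _)); apply: lerD;
  by rewrite normrM (gtr0_norm (_ : 0 < _)) // ler_pM2l // H ?inE ?eqxx ?orbT.
by rewrite normrM (gtr0_norm (_ : 0 < _)) // ler_pM2l // H ?inE ?eqxx ?orbT.
Qed.

Lemma one_step_affine f g (a c : R) y :
  Q (fun z => a * (f z - g z) + c) y = a * (Q f y - Q g y) + c.
Proof.
transitivity (a * (Q f y - Q g y) + (lam + mu1 + mu2) * c).
  rewrite /one_step; ring.
by rewrite sum_eq1 mul1r.
Qed.

(** The functional f(Y_tau) 1(tau <= n) of the word s of the first n steps.
    Reading s from its first letter makes the first-step recursion of [reach]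
    immediate. *)
Fixpoint hit_value f y s : R :=
  if in_dB y then f y
  else if s is v :: s' then hit_value f (move y v) s' else 0.

(** The probability of a step; the last branch is only meant for (0, -1), as
    words contain no other letter. *)
Definition weight v : R :=
  if v == (-1, 0) then lam else if v == (1, 1) then mu1 else mu2.

Fixpoint words (n : nat) : seq (seq site) :=
  if n is m.+1 then
    [seq v :: s | v <- steps, s <- words m]
  else [:: [::]].

Definition word_mean n (Phi : seq site -> R) : R :=
  \sum_(s <- words n) (\prod_(v <- s) weight v) * Phi s.

Lemma word_mean0 Phi : word_mean 0 Phi = Phi [::].
Proof. by rewrite /word_mean big_seq1 big_nil mul1r. Qed.

Lemma word_meanS n Phi : word_mean n.+1 Phi =
  lam * word_mean n (fun s => Phi ((-1, 0) :: s)) +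
  mu1 * word_mean n (fun s => Phi ((1, 1) :: s)) +
  mu2 * word_mean n (fun s => Phi ((0, -1) :: s)).
Proof.
rewrite /word_mean /= cats0 !big_cat !big_map /= -!addrA !mulr_sumr.
congr (_ + (_ + _)); apply: eq_bigr => s _; by rewrite big_cons mulrA.
Qed.

Lemma word_mean_cst n c : word_mean n (fun=> c) = c.
Proof.
elim: n => [|n IH]; first exact: word_mean0.
by rewrite word_meanS IH -!mulrDl sum_eq1 mul1r.
Qed.

(** E_y[f(Y_tau); tau <= n], as a finite sum. *)
Definition reach n f y := word_mean n (hit_value f y).

Lemma reach_dB n f y : in_dB y -> reach n f y = f y.
Proof.
move=> dy; rewrite /reach -[RHS](word_mean_cst n); congr word_mean.
by apply/funext => -[|v s] /=; rewrite dy.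
Qed.

Lemma reach0 f y : ~~ in_dB y -> reach 0 f y = 0.
Proof. by move=> dy; rewrite /reach word_mean0 /= (negbTE dy). Qed.

Lemma reachS n f y : ~~ in_dB y -> reach n.+1 f y = Q (reach n f) y.
Proof. by move=> /negbTE dy; rewrite /reach word_meanS /= dy. Qed.

Lemma reach_ge0 n f y : (forall z, 0 <= f z) -> 0 <= reach n f y.
Proof.
move=> f0; elim: n y => [|n IH] y; have [dy|dy] := boolP (in_dB y);
  try by rewrite reach_dB.
  by rewrite reach0.
by rewrite reachS // /one_step !addr_ge0 // mulr_ge0 // ltW.
Qed.

(** The word of left steps alone closes a gap of at most M. *)
Lemma reach_close M y : in_B y -> y.1 - y.2 <= M%:Z ->
  lam ^+ M <= reach M (fun=> 1) y.
Proof.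
elim: M y => [|M IH] y By; have [dy|dy] := boolP (in_dB y) => hM.
- by rewrite reach_dB // expr0.
- by exfalso; case: y By dy hM => a b;
  rewrite /in_B /in_dB /in_halfplane /=; lia.
- rewrite reach_dB // exprn_ile1 //; [exact: ltW | exact: lam_le1].
- rewrite reachS // /one_step exprS.
  have le1 : lam * lam ^+ M <= lam * reach M (fun=> 1) (move y (-1, 0)).
    rewrite ler_pM2l //; apply: IH; first by rewrite B_move ?inE.
    by rewrite move_left //=; lia.
  have := @reach_ge0 M (fun=> 1) (move y (1, 1)) (fun=> ler01).
  have := @reach_ge0 M (fun=> 1) (move y (0, -1)) (fun=> ler01).
  by move=> /(mulr_ge0 (ltW mu2_gt0)) ? /(mulr_ge0 (ltW mu1_gt0)) ?; lra.
Qed.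

(** With f = 1, [reach] is P_y(tau <= n), so the bracket is
    P_y(n < tau <= n + M).  For n = 0 the bound holds by [reach_close] when the
    gap is at most M and by the decay of V otherwise; it then propagates in n
    because off dB both sides obey the same first-step recursion, and on dB
    the left-hand side is 0. *)
Lemma harmonic_defect (V : site -> R) (K r : R) (M n : nat) y :
  0 <= K -> 0 <= r <= 1 ->
  harmonic_off_dB lam mu1 mu2 V ->
  (forall z, in_B z -> `|V z| <= K * r ^ (z.1 - z.2)) ->
  in_B y ->
  `|V y - reach n V y| <=
    K / lam ^+ M * (reach (n + M) (fun=> 1) y - reach n (fun=> 1) y)
    + K * r ^+ M.
Proof.
move=> K0 /andP[r0 r1] hV leV; elim: n y => [|n IH] y By;
  have [dy|dy] := boolP (in_dB y); rewrite ?addSn.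
- by rewrite !reach_dB // !subrr normr0 mulr0 add0r mulr_ge0 ?exprn_ge0.
- rewrite !reach0 // !subr0 add0n; apply: (le_trans (leV _ By)).
  have [yM|yM] := leP (y.1 - y.2) M%:Z.
    rewrite -mulrA -[leLHS]addr0; apply: lerD;
      last by rewrite mulr_ge0 ?exprn_ge0.
    rewrite ler_wpM2l //; apply: (@le_trans _ _ 1).
      have := gap_ge0 By; case: (y.1 - y.2) => // k _.
      by rewrite -exprnP exprn_ile1.
    by rewrite ler_pdivlMl ?exprn_gt0 // mulr1 reach_close.
  rewrite -[leLHS]add0r; apply: lerD.
    by rewrite mulr_ge0 ?reach_ge0 // divr_ge0 // exprn_ge0 ?ltW.
  rewrite ler_wpM2l //; case: (y.1 - y.2) yM => // k; rewrite ltz_nat => Mk.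
  by rewrite -exprnP ler_wiXn2l // ltnW.
- by rewrite !reach_dB // !subrr normr0 mulr0 add0r mulr_ge0 ?exprn_ge0.
rewrite !reachS // -{1}(hV _ By dy) -one_stepB.
rewrite -one_step_affine //; apply: le_norm_one_step => v vs.
by apply: IH; exact: B_move.
Qed.

(** In [harmonic_defect], M is chosen first to make K r^M small; the increment
    over M steps of a convergent sequence then vanishes as n grows. *)
Lemma reach_cvg (V : site -> R) (K r : R) y :
  0 <= K -> 0 <= r < 1 -> harmonic_off_dB lam mu1 mu2 V ->
  (forall z, in_B z -> `|V z| <= K * r ^ (z.1 - z.2)) -> in_B y ->
  cvgn (fun n => reach n (fun=> 1) y) ->
  reach n V y @[n --> \oo] --> V y.
Proof.
move=> K0 /andP[r0 r1] hV leV By cu; apply/cvgrPdist_le => e e0.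
have /cvgrPdist_lt/(_ _ (divr_gt0 e0 (ltr0n R 2))) [M _ HM] :
    K * r ^+ n @[n --> \oo] --> (0 : R).
  rewrite -[X in _ --> X](mulr0 K); apply: cvgMr.
  by apply: cvg_expr; rewrite ger0_norm.
have {HM} := HM M (leqnn M); rewrite sub0r normrN.
rewrite ger0_norm ?mulr_ge0 ?exprn_ge0 // => HM.
have : K / lam ^+ M * (reach (n + M) (fun=> 1) y - reach n (fun=> 1) y)
    @[n --> \oo] --> (0 : R).
  rewrite -[X in _ --> X](mulr0 (K / lam ^+ M)); apply: cvgMr.
  rewrite -(subrr (limn (fun n => reach n (fun=> 1) y))).
  apply: cvgB => //.
  by rewrite (cvg_shiftn M (fun n => reach n (fun=> 1) y)).
move=> /cvgrPdist_lt/(_ _ (divr_gt0 e0 (ltr0n R 2))).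
apply: filterS => n; rewrite sub0r normrN => /(le_lt_trans (ler_norm _)) Hn.
have r01 : 0 <= r <= 1 by rewrite r0 ltW.
apply: (le_trans (harmonic_defect M n K0 r01 hV leV By)).
by rewrite [leRHS](splitr e) lerD // ltW.
Qed.

End OneStep.

(** * The law of the first steps *)

Lemma words_uniq n : uniq (words n).
Proof.
elim: n => [//|n IH]; apply: allpairs_uniq => //.
by move=> [v s] [v' s'] _ _ /= [-> ->].
Qed.

Lemma words_size n s : s \in words n -> size s = n.
Proof.
elim: n s => [|n IH] s; first by rewrite inE => /eqP ->.
by move=> /allpairsP[[v t]] [_ /= tn ->] /=; rewrite IH.
Qed.

Lemma words_all n s :
  s \in words n -> all (fun v => v \in steps) s.
Proof.
elim: n s => [|n IH] s; first by rewrite inE => /eqP ->.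
by move=> /allpairsP[[v t]] [vs /= tn ->] /=; rewrite IH // andbT.
Qed.

Section MeasurableCountable.
Context d (T : measurableType d).

(** Words of steps form a countable type, so every functional of them is
    measurable once their fibres are. *)
Lemma measurable_preimage_countable (U : countType) (g : T -> U) (A : set U) :
  (forall u, measurable (g @^-1` [set u])) -> measurable (g @^-1` A).
Proof.
move=> mg.
rewrite (_ : _ @^-1` _ = \bigcup_u (if u \in A then g @^-1` [set u] else set0)).
  apply: countable_bigcupT_measurable => [|u]; first exact: countableP.
  by case: ifP => // _; exact: measurable0.
apply/seteqP; split=> [w Aw|w [u _]].
  by exists (g w) => //; rewrite mem_set.
by case: ifPn => // /set_mem Au /= ->.
Qed.
End MeasurableCountable.

Lemma measurable_set1_site (v : site) : measurable [set v].
Proof.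
rewrite (_ : [set v] = [set v.1] `*` [set v.2]); first exact: measurableX.
by apply/seteqP; split=> [_ -> //|[a b] /= [-> ->]]; case: v.
Qed.

Definition first_steps d (T : measurableType d) (R : realType)
    (P : probability T R) (J : nat -> {RV P >-> site}) (n : nat) (w : T) :
    seq site :=
  [seq J i w | i <- iota 0 n].

Section Law.
Context d (T : measurableType d) (R : realType) (P : probability T R).
Variables (lam mu1 mu2 : R) (J : nat -> {RV P >-> site}).
Hypotheses (sum_eq1 : lam + mu1 + mu2 = 1) (J_iid : iid_steps lam mu1 mu2 J).

Lemma first_steps_fiber n (s : seq site) : first_steps J n @^-1` [set s] =
  if size s == n then
    \bigcap_(i in [set` iota 0 n]) (J i @^-1` [set nth (0, 0) s i])
  else set0.
Proof.
apply/seteqP; split=> w /=.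
  move=> <-; rewrite size_map size_iota eqxx => i /=; rewrite mem_iota => ni.
  by rewrite (nth_map 0%N) ?size_iota // nth_iota.
case: eqP => // sn H; apply: (@eq_from_nth _ (0, 0)).
  by rewrite size_map size_iota sn.
move=> i; rewrite size_map size_iota => ni.
rewrite (nth_map 0%N) ?size_iota // nth_iota //.
by apply: H; rewrite /= mem_iota.
Qed.

Lemma measurable_first_steps n (A : set (seq site)) :
  measurable (first_steps J n @^-1` A).
Proof.
apply: measurable_preimage_countable => s; rewrite first_steps_fiber.
case: ifP => // _; apply: fin_bigcap_measurable => [|i _].
  exact: finite_seq.
rewrite -[X in measurable X]setTI.
by apply: measurable_funP => //; exact: measurable_set1_site.
Qed.

Lemma measurable_first_steps_fun n (Phi : seq site -> R) :
  measurable_fun setT (fun w => Phi (first_steps J n w)).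
Proof.
by move=> _ Y _; rewrite setTI; exact: (measurable_first_steps n (Phi @^-1` Y)).
Qed.

(** The product rule for the events J_i = s_i, i < n, over the index list
    0, ..., n-1. *)
Lemma prob_first_steps n s : s \in words n ->
  P (first_steps J n @^-1` [set s]) = (\prod_(v <- s) weight lam mu1 mu2 v)%:E.
Proof.
move=> sn; have ss := words_size sn.
rewrite first_steps_fiber ss eqxx (steps_indep J_iid) ?iota_uniq //; last first.
  by move=> i; exact: measurable_set1_site.
rewrite (big_nth (0, 0)) /index_iota subn0 ss -prodEFin.
rewrite big_seq [RHS]big_seq; apply: eq_bigr => i; rewrite mem_iota add0n => ni.
have /allP/(_ (nth (0, 0) s i)) := words_all sn.
rewrite mem_nth ?ss // => /(_ isT); rewrite !inE => /or3P[] /eqP ->.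
- by rewrite (steps_left J_iid).
- by rewrite (steps_diag J_iid).
- by rewrite (steps_down J_iid).
Qed.

(** A functional of the first n steps agrees, as long as only the three
    prescribed steps occur, with a simple function. *)
Lemma sum_first_steps_indic n (Phi : seq site -> R) (w : T) :
  \sum_(s <- words n) Phi s * \1_(first_steps J n @^-1` [set s]) w =
  if first_steps J n w \in words n then Phi (first_steps J n w) else 0.
Proof.
have E s : \1_(first_steps J n @^-1` [set s]) w =
    (s == first_steps J n w)%:R :> R.
  rewrite indicE; congr (_%:R); congr nat_of_bool.
  apply/idP/eqP => [/set_mem //|->].
  by rewrite mem_set.
under eq_bigr do rewrite E.
case: ifPn => [win|win].
  rewrite (bigD1_seq (first_steps J n w)) ?words_uniq //=.
  rewrite eqxx mulr1 big1 ?addr0 //.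
  by move=> s /negbTE ->; rewrite mulr0.
rewrite big_seq big1 // => s sn; case: eqP => [st|]; last by rewrite mulr0.
by rewrite -st sn in win.
Qed.

Lemma integral_sum_first_steps n (Phi : seq site -> R) :
  (\int[P]_w (\sum_(s <- words n)
     Phi s * \1_(first_steps J n @^-1` [set s]) w)%:E
   = (word_mean lam mu1 mu2 n Phi)%:E)%E.
Proof.
under eq_integral do rewrite -sumEFin.
rewrite integral_sum //=; last first.
  move=> s; under eq_fun do rewrite EFinM.
  apply: integrableZl => //; apply: integrable_indic => //.
  exact: measurable_first_steps.
rewrite /word_mean -sumEFin big_seq [RHS]big_seq; apply: eq_bigr => s sn.
under eq_integral do rewrite EFinM.
rewrite integralZl //; last first.
  by apply: integrable_indic => //; exact: measurable_first_steps.
rewrite integral_indic //; last exact: measurable_first_steps.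
by rewrite setIT [X in (_ * X)%E](prob_first_steps sn) -EFinM mulrC.
Qed.

(** The words of length n have total weight (lam + mu1 + mu2)^n = 1, so no
    probability is left for other step values. *)
Lemma ae_first_steps_words n : {ae P, forall w, first_steps J n w \in words n}.
Proof.
pose A := first_steps J n @^-1` [set` words n].
have mA : measurable A by exact: measurable_first_steps.
have PA : P A = 1%E.
  rewrite -[RHS](congr1 EFin (word_mean_cst sum_eq1 n 1)).
  rewrite -integral_sum_first_steps.
  under eq_integral do rewrite sum_first_steps_indic.
  rewrite -[X in P X]setIT -(integral_indic _ measurableT mA).
  apply: eq_integral => w _; rewrite indicE /A.
  case: ifPn => win; first by rewrite mem_set.
  by rewrite memNset //=; apply/negP.
exists (~` A); split => //; first exact: measurableC.
by rewrite probability_setC // PA subee.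
Qed.

Lemma expectation_first_steps n (Phi : seq site -> R) :
  ('E_P[fun w => Phi (first_steps J n w)] = (word_mean lam mu1 mu2 n Phi)%:E)%E.
Proof.
rewrite unlock -integral_sum_first_steps; apply: ae_eq_integral => //.
- by apply/measurable_EFinP; exact: measurable_first_steps_fun.
- apply/measurable_EFinP; apply: measurable_sum => s.
  apply: measurable_funM => //; apply: measurable_indic.
  exact: measurable_first_steps.
apply: filterS (ae_first_steps_words n) => w wn _.
by rewrite sum_first_steps_indic wn.
Qed.

(** * Stopping the walk at the boundary *)

Lemma walk_foldl y k w : walk J y k w = foldl move y (first_steps J k w).
Proof.
have first_stepsS k' :
    first_steps J k'.+1 w = rcons (first_steps J k' w) (J k' w).
  by rewrite /first_steps -addn1 iotaD map_cat cats1.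
by elim: k => [//|k IH]; rewrite first_stepsS foldl_rcons -IH.
Qed.

Lemma take_first_steps k n w : (k <= n)%N ->
  take k (first_steps J n w) = first_steps J k w.
Proof.
by move=> kn; rewrite /first_steps -map_take take_iota (minn_idPl kn).
Qed.

Lemma hit_value_first (f : site -> R) y s k : (k <= size s)%N ->
  in_dB (foldl move y (take k s)) ->
  (forall i, (i < k)%N -> ~~ in_dB (foldl move y (take i s))) ->
  hit_value f y s = f (foldl move y (take k s)).
Proof.
elim: s y k => [|v s IH] y [|k] //=; try by rewrite ?take0 => _ /= ->.
move=> ks dk Hk; rewrite (negbTE (Hk 0%N isT)).
by apply: IH => // i ik; exact: (Hk i.+1).
Qed.

Lemma hit_value_never (f : site -> R) y s :
  (forall i, ~~ in_dB (foldl move y (take i s))) -> hit_value f y s = 0.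
Proof.
elim: s y => [|v s IH] y Hk /=; rewrite (negbTE (Hk 0%N)) //.
by apply: IH => i; exact: (Hk i.+1).
Qed.

Lemma hit_value_bound (f : site -> R) K y s : 0 <= K ->
  (forall z, in_dB z -> `|f z| <= K) -> `|hit_value f y s| <= K.
Proof.
move=> K0 fK; elim: s y => [|v s IH] y /=; case: ifPn => dy;
  by rewrite ?normr0 ?fK ?IH.
Qed.

Lemma hit_value_cvg (f : site -> R) y w :
  hit_value f y (first_steps J n w) @[n --> \oo] --> stopped_payoff J f y w.
Proof.
apply: cvg_near_cst; rewrite /stopped_payoff /tau.
case: pselect => [hit|nohit].
  case: ex_minnP => k dk mk; exists k => // n /= kn.
  rewrite walk_foldl -(take_first_steps _ kn); apply: hit_value_first.
  - by rewrite size_map size_iota.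
  - by rewrite take_first_steps // -walk_foldl.
  move=> i ik; rewrite take_first_steps; last by rewrite (leq_trans (ltnW ik)).
  by rewrite -walk_foldl; apply/negP => /mk; rewrite leqNgt ik.
exists 0%N => // n _; apply: hit_value_never => i; apply/negP => di.
apply: nohit; have [i_n|n_i] := leqP i n.
  by exists i; rewrite walk_foldl -(take_first_steps _ i_n).
exists n; rewrite walk_foldl; move: di.
by rewrite take_oversize // size_map size_iota ltnW.
Qed.

(** For each outcome, f(Y_tau) 1(tau <= n) is eventually constant in n, and it
    is bounded by K; dominated convergence applies.  With f = 1 this also
    yields the convergence of P_y(tau <= n) required by [reach_cvg]. *)
Lemma expectation_stopped (f : site -> R) K y : 0 <= K ->
  (forall z, in_dB z -> `|f z| <= K) ->
  P.-integrable setT (EFin \o stopped_payoff J f y) /\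
  (reach lam mu1 mu2 n f y)%:E @[n --> \oo] --> 'E_P[stopped_payoff J f y]%E.
Proof.
move=> K0 fK.
pose F n w := (hit_value f y (first_steps J n w))%:E.
have mF n : measurable_fun setT (F n).
  apply/measurable_EFinP.
  exact: (measurable_first_steps_fun n (hit_value f y)).
have Fcvg w : F^~ w @ \oo --> (EFin \o stopped_payoff J f y) w.
  by apply: cvg_EFin; [exact: nearW | exact: hit_value_cvg].
have [] := @dominated_convergence _ _ _ P _ measurableT F
  (EFin \o stopped_payoff J f y) (cst K%:E) mF.
- by apply: emeasurable_fun_cvg mF _ => w _; exact: Fcvg.
- by apply: aeW => w _; exact: Fcvg.
- exact: finite_measure_integrable_cst.
- by apply: aeW => w n _; rewrite lee_fin hit_value_bound.
move=> ? _ H; split=> //; rewrite unlock.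
apply: cvg_trans H.
rewrite (_ : (fun n => _) = (fun n => \int[P]_w F n w)%E) //.
apply/funext => n; rewrite /F.
by have := expectation_first_steps n (hit_value f y); rewrite unlock => ->.
Qed.

End Law.

Section Exit.
Context d (T : measurableType d) (R : realType) (P : probability T R).
Variables (lam mu1 mu2 : R) (J : nat -> {RV P >-> site}).
Hypotheses (lam_gt0 : 0 < lam) (mu1_gt0 : 0 < mu1) (mu2_gt0 : 0 < mu2).
Hypotheses (sum_eq1 : lam + mu1 + mu2 = 1) (J_iid : iid_steps lam mu1 mu2 J).

Lemma expectation_walk1 (V : site -> R) y :
  'E_P[V \o walk J y 1]%E = (one_step lam mu1 mu2 V y)%:E.
Proof.
rewrite (_ : V \o _ =
    fun w => V (foldl move y (first_steps J 1 w))); last first.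
  by apply/funext => w; rewrite /comp walk_foldl.
rewrite (expectation_first_steps sum_eq1 J_iid 1 (fun s => V (foldl move y s))).
by rewrite word_meanS !word_mean0.
Qed.

(** Both V(y) and the expected payoff are limits of [reach]. *)
Lemma harmonic_determined (V : site -> R) (K r : R) y :
  0 <= K -> 0 <= r < 1 -> harmonic_off_dB lam mu1 mu2 V ->
  (forall z, in_B z -> `|V z| <= K * r ^ (z.1 - z.2)) -> in_B y ->
  P.-integrable setT (EFin \o stopped_payoff J V y) /\
  'E_P[stopped_payoff J V y]%E = (V y)%:E.
Proof.
move=> K0 r01 hV leV By.
have Vle z : in_dB z -> `|V z| <= K.
  move=> /andP[z2 /eqP z12].
  by have := leV z; rewrite /in_B z2 z12 lexx subrr expr0z mulr1; exact.
have [intV cvgV] := expectation_stopped sum_eq1 J_iid y K0 Vle.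
have le1 (z : site) : in_dB z -> `|1 : R| <= 1 by rewrite normr1.
have [int1 cvg1] :=
  expectation_stopped (f := fun=> 1) sum_eq1 J_iid y ler01 le1.
split=> //.
have cu : cvgn (fun n => reach lam mu1 mu2 n (fun=> 1) y).
  have fin1 : 'E_P[stopped_payoff J (fun=> 1%R) y]%E \is a fin_num.
    by rewrite unlock; exact: integrable_fin_num.
  move: cvg1; rewrite -(fineK fin1) => /fine_cvg c.
  by apply/cvg_ex; eexists; exact: c.
apply: (cvg_unique _ cvgV) => //; apply: cvg_EFin; first exact: nearW.
exact: (reach_cvg lam_gt0 mu1_gt0 mu2_gt0 sum_eq1 K0 r01 hV leV By cu).
Qed.

Lemma stopped_payoff_one_on_dB (W : site -> R) y :
  (forall z, in_dB z -> W z = 1) -> stopped_payoff J W y = \1_(hits J y).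
Proof.
move=> W1; apply/funext => w; rewrite indicE /hits /stopped_payoff.
case E : (tau J y w) => [k|]; last by rewrite memNset //= E.
rewrite mem_set /= ?E // W1 //; move: E; rewrite /tau.
by case: pselect => // hit; case: ex_minnP => m dm _ [<-].
Qed.

End Exit.

(** * Geometric harmonic functions *)

Definition geom {R : realType} (beta alpha : R) (y : site) : R :=
  beta ^ (y.1 - y.2) * alpha ^ y.2.

Lemma geom_bound (R : realType) (beta alpha r : R) y : in_B y ->
  0 <= beta <= r -> 0 <= alpha <= 1 -> `|geom beta alpha y| <= r ^ (y.1 - y.2).
Proof.
move=> By /andP[b0 br] /andP[a0 a1]; have := gap_ge0 By.
have : 0 <= y.2 by have /andP[] := By.
rewrite /geom; case: (y.2) => // n _; case: (y.1 - _) => // k _.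
rewrite -!exprnP ger0_norm ?mulr_ge0 ?exprn_ge0 // -[leRHS]mulr1.
by rewrite ler_pM ?exprn_ge0 ?exprn_ile1 // lerXn2r // nnegrE (le_trans b0).
Qed.

(** On the axis y(2) = 0 the downward step is replaced by staying put: its
    contribution is mu2 instead of mu2 beta/alpha, a difference of
    C(beta, alpha). *)
Lemma one_step_geom (R : realType) (lam mu1 mu2 beta alpha : R) y :
  beta != 0 -> alpha != 0 -> in_B y ->
  one_step lam mu1 mu2 (geom beta alpha) y =
    (lam / beta + mu1 * alpha + mu2 * (beta / alpha)
     + (y.2 == 0)%:R * C mu2 beta alpha) * geom beta alpha y.
Proof.
move=> b0 a0 By; rewrite /one_step move_left // move_diag // move_down //.
rewrite /geom /C; case: y By => a b /= _.
rewrite (_ : a - 1 - b = (a - b) + (- 1)); last by ring.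
rewrite (_ : a + 1 - (b + 1) = a - b); last by ring.
case: eqVneq => [->|_] /=.
  rewrite subr0 add0r expr0z expr1z expfzDr // -invr_expz expr1z.
  by field; rewrite ?b0 ?a0.
rewrite (_ : a - (b - 1) = (a - b) + 1); last by ring.
move: (a - b) => x.
rewrite !(expfzDr _ _ a0) !(expfzDr _ _ b0) -!invr_expz !expr1z.
by field; rewrite ?b0 ?a0.
Qed.

Lemma charpoly_eq1 (R : realType) (lam mu1 mu2 : R) :
  0 < lam -> 0 < mu1 -> 0 < mu2 -> lam + mu1 + mu2 = 1 ->
  let p beta alpha := lam / beta + mu1 * alpha + mu2 * (beta / alpha) in
  [/\ p (lam / mu2) 1 = 1, p (lam / mu2) (lam / mu1) = 1 &
      p (lam / mu1) (lam / mu1) = 1].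
Proof.
move=> /lt0r_neq0 l0 /lt0r_neq0 m10 /lt0r_neq0 m20 E p; rewrite /p.
by split; rewrite -[RHS]E; field; rewrite ?l0 ?m10 ?m20.
Qed.

Theorem proposition3p6 (R : realType) (d : measure_display)
  (T : measurableType d) (P : probability T R)
  (lam mu1 mu2 rho1 rho2 : R) (J : nat -> {RV P >-> site})
  (lam_gt0 : 0 < lam) (mu1_gt0 : 0 < mu1) (mu2_gt0 : 0 < mu2)
  (sum_eq1 : lam + mu1 + mu2 = 1)
  (rho1E : rho1 = lam / mu1) (rho2E : rho2 = lam / mu2)
  (J_iid : iid_steps lam mu1 mu2 J)
  (lam_mu1 : lam < mu1) (lam_mu2 : lam < mu2) (mu1_neq_mu2 : mu1 != mu2) :
  dB_determined J (h_rho2 mu2 rho1 rho2) /\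
  forall y : site, in_B y ->
    P (hits J y) =
      ((C mu2 rho2 rho1)^-1 * h_rho2 mu2 rho1 rho2 y
       + C mu2 rho2 1 / C mu2 rho2 rho1
         * (rho1 ^ (y.1 - y.2) * rho1 ^ y.2))%:E /\
    P (hits J y) =
      (rho2 ^ (y.1 - y.2)
       + (mu2 - lam) / (mu1 - mu2) * (rho2 ^ (y.1 - y.2) * rho1 ^ y.2)
       + (mu2 - lam) / (mu2 - mu1) * (rho1 ^ (y.1 - y.2) * rho1 ^ y.2))%:E.
Proof.
have [l0 m10 m20] : [/\ lam != 0, mu1 != 0 & mu2 != 0] by rewrite !lt0r_neq0.
have rho1_gt0 : 0 < rho1 by rewrite rho1E divr_gt0.
have rho2_gt0 : 0 < rho2 by rewrite rho2E divr_gt0.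
have rho1_lt1 : rho1 < 1 by rewrite rho1E ltr_pdivrMr // mul1r.
have rho2_lt1 : rho2 < 1 by rewrite rho2E ltr_pdivrMr // mul1r.
have [r10 r20] : rho1 != 0 /\ rho2 != 0 by rewrite !lt0r_neq0.
have C1E : C mu2 rho2 rho1 = mu2 - mu1.
  by rewrite /C rho1E rho2E; field; rewrite ?l0 ?m10 ?m20.
have C2E : C mu2 rho2 1 = mu2 - lam.
  by rewrite /C rho2E; field.
have m12 : mu2 - mu1 != 0 by rewrite subr_eq0 eq_sym.
have [p21 p2 p1] := charpoly_eq1 lam_gt0 mu1_gt0 mu2_gt0 sum_eq1.
rewrite -rho1E -rho2E in p21 p2 p1.
set h := h_rho2 mu2 rho1 rho2.
pose g := geom rho1 rho1.
pose W y := (C mu2 rho2 rho1)^-1 * h y + C mu2 rho2 1 / C mu2 rho2 rho1 * g y.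
have hE y :
    h y = C mu2 rho2 rho1 * geom rho2 1 y - C mu2 rho2 1 * geom rho2 rho1 y.
  by rewrite /h /h_rho2 /geom exp1rz mulr1.
have harm_h y : in_B y -> one_step lam mu1 mu2 h y = h y.
  move=> By; transitivity
    (C mu2 rho2 rho1 * one_step lam mu1 mu2 (geom rho2 1) y
     - C mu2 rho2 1 * one_step lam mu1 mu2 (geom rho2 rho1) y).
    by rewrite /one_step !hE; ring.
  rewrite !one_step_geom ?oner_neq0 // p21 p2 hE.
  (* At y(2) = 0 both geometric functions equal rho2^x: the defects cancel. *)
  case: eqVneq => [y0|_] /=; last by ring.
  by rewrite /geom y0 !expr0z; ring.
have harm_g y : in_B y -> one_step lam mu1 mu2 g y = g y.
  move=> By; rewrite /g one_step_geom // p1.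
  by rewrite [C _ _ _]/C divff // subrr !mulr0 addr0 mul1r.
(* A single decay rate for both functions: W mixes powers of rho1 and rho2. *)
pose r := Num.max rho1 rho2.
have r01 : 0 <= r < 1 by rewrite le_max (ltW rho1_gt0) /= gt_max rho1_lt1.
have geom_le beta alpha y : in_B y -> beta \in [:: rho1; rho2] ->
    0 < alpha <= 1 -> `|geom beta alpha y| <= r ^ (y.1 - y.2).
  move=> By bs /andP[a0 a1]; apply: geom_bound => //; last by rewrite ltW.
  move: bs; rewrite !inE => /orP[] /eqP ->;
    by rewrite le_max lexx ?orbT ltW.
pose K := `|C mu2 rho2 rho1| + `|C mu2 rho2 1|.
have K0 : 0 <= K by rewrite addr_ge0.
have h_le y : in_B y -> `|h y| <= K * r ^ (y.1 - y.2).
  move=> By; rewrite hE mulrDl; apply: (le_trans (ler_normB _ _)).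
  by rewrite !(normrM _ (geom _ _ _)) lerD // ler_wpM2l // geom_le ?inE ?eqxx
    ?orbT ?ltr01 ?lexx ?rho1_gt0 ?(ltW rho1_lt1).
pose KW := `|(C mu2 rho2 rho1)^-1| * K + `|C mu2 rho2 1 / C mu2 rho2 rho1|.
have KW0 : 0 <= KW by rewrite addr_ge0 // mulr_ge0.
have W_le y : in_B y -> `|W y| <= KW * r ^ (y.1 - y.2).
  move=> By; rewrite mulrDl; apply: (le_trans (ler_normD _ _)).
  rewrite (normrM _ (h y)) (normrM _ (g y)) -mulrA.
  apply: lerD; rewrite ler_wpM2l //; first exact: h_le.
  by rewrite geom_le ?inE ?eqxx ?rho1_gt0 ?(ltW rho1_lt1).
have harm_W : harmonic_off_dB lam mu1 mu2 W.
  move=> y By _; rewrite /W -(harm_h _ By) -(harm_g _ By) /one_step; ring.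
(* For x = 0 the powers of rho1 in W cancel. *)
have W1 z : in_dB z -> W z = 1.
  move=> /andP[_ /eqP z12]; rewrite /W hE /g /geom z12 subrr !expr0z exp1rz C1E.
  by field.
split.
  split=> [y By|]; first by rewrite (expectation_walk1 sum_eq1 J_iid) harm_h.
  exists h => y By.
  by have [? ->] := harmonic_determined lam_gt0 mu1_gt0 mu2_gt0 sum_eq1 J_iid
    K0 r01 (fun z Bz _ => harm_h z Bz) h_le By.
move=> y By.
have hitsW : P (hits J y) = (W y)%:E.
  have [intW <-] := harmonic_determined lam_gt0 mu1_gt0 mu2_gt0 sum_eq1 J_iid
    KW0 r01 harm_W W_le By.
  rewrite (stopped_payoff_one_on_dB J y W1) expectation_indic //.
  rewrite -[hits J y]setTI (_ : hits J y = stopped_payoff J W y @^-1` [set 1]).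
    by have /measurable_int/measurable_EFinP := intW; exact.
  rewrite (stopped_payoff_one_on_dB J y W1); apply/seteqP; split=> w /=.
    by move=> hw; rewrite indicE mem_set.
  rewrite indicE; case: (boolP (w \in hits J y)) => [/set_mem //|_ /eqP].
  by rewrite eq_sym oner_eq0.
split; rewrite hitsW //; congr EFin.
rewrite /W hE /g /geom exp1rz C1E C2E.
by field; rewrite m12 subr_eq0 mu1_neq_mu2.
Qed.
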